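(* For each integer $m\geq 1$, the partitions $\lambda$ of $2m$ with cyclicity index $c(\lambda)=0$ are in bijective correspondence with the partitions of $m$ into triangular numbers (i.e. multisets of numbers of the form $i(i+1)/2$, $i\geq 1$, summing to $m$).
   Context: A partition of a positive integer $n$ is a tuple $\lambda=(n_1,n_2,\dots,n_r)$ of positive integers with $n_1\geq n_2\geq\dots\geq n_r$ and $n_1+\dots+n_r=n$. The cyclicity index of $\lambda$ is $c(\lambda)=\sum_{i=1}^r(3-2i)n_i$. The triangular numbers are the numbers $i(i+1)/2$ for integers $i\geq 1$. *)

(* Defs.v *)
From HB Require Import structures.
From mathcomp Require Import all_boot all_order all_algebra.

Set Implicit Arguments.
Unset Strict Implicit.
Unset Printing Implicit Defensive.

Import Order.TTheory GRing.Theory Num.Theory.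

Definition is_partition (n : nat) (s : seq nat) : bool :=
  [&& sorted geq s, all (fun k => 0 < k) s & sumn s == n].

(* The entry n_i, i >= 1, of the partition is [nth 0 s i.-1]. *)
Definition cyclicity_index (s : seq nat) : int :=
  (\sum_(1 <= i < (size s).+1) (3 - 2 * i%:Z) * (nth 0%N s i.-1)%:Z)%R.

(* The bound i <= t makes the predicate decidable and loses nothing, since
   i <= i (i + 1) / 2; see [triangularP]. *)
Definition triangular (t : nat) : bool :=
  [exists i : 'I_t.+1, (1 <= i) && (t == (i * (i + 1)) %/ 2)].

Lemma triangularP (t : nat) :
  reflect (exists2 i : nat, 1 <= i & t = (i * (i + 1)) %/ 2) (triangular t).
Proof.
apply: (iffP existsP) => [[i /andP[i1 /eqP e]]|[i i1 e]]; first by exists (val i).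
have it : i < t.+1.
  by rewrite ltnS e leq_divRL // leq_mul2l addn1 ltnS i1 orbT.
by exists (Ordinal it); rewrite /= i1 -e eqxx.
Qed.

Definition cyclicity_zero_partition (n : nat) : Type :=
  {s : seq nat | is_partition n s && (cyclicity_index s == 0%R)}.

Definition triangular_partition (n : nat) : Type :=
  {s : seq nat | is_partition n s && all triangular s}.

(* Main.v *)
(** Write [n_1, n_2, ...] for the parts. The equation [c = 0] says
    [n_1 = n_2 + 3 n_3 + 5 n_4 + ...], so [n_1 >= n_2] is automatic and the
    total is [2 (n_2 + 2 n_3 + 3 n_4 + ...)]. Dropping [n_1] therefore leaves an
    arbitrary partition [mu] with [mu_1 + 2 mu_2 + 3 mu_3 + ... = m]; since
    [1 + ... + k = k (k + 1) / 2], this weighted sum is the sum of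
    [k (k + 1) / 2] over the parts [k] of the conjugate of [mu]. *)
Require Import Defs.
From mathcomp Require Import all_boot all_order all_algebra.
From mathcomp Require Import zify.

Set Implicit Arguments.
Unset Strict Implicit.
Unset Printing Implicit Defensive.

Definition parts (s : seq nat) : bool := sorted geq s && all (ltn 0) s.

(** Column lengths of the Young diagram of [s]; when [s] is sorted, its head is the number of
    columns. *)
Definition conj_part (s : seq nat) : seq nat :=
  mkseq (fun j => count (ltn j) s) (head 0 s).

Lemma parts_behead a s : parts (a :: s) -> parts s.
Proof. by case/andP=> /= /path_sorted Hs /andP[_ Ha]; rewrite /parts Hs. Qed.

Lemma eq_ltn (a b : nat) : (forall j, (j < a) = (j < b)) -> a = b.
Proof.
move=> e; apply/eqP; rewrite eqn_leq.
by rewrite [a <= b]leqNgt e ltnn [b <= a]leqNgt -e ltnn.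
Qed.

Lemma sorted_geq_le_head a s : sorted geq (a :: s) -> forall x, x \in s -> x <= a.
Proof.
move=> /= Hs x xs; have tr : transitive geq by move=> y u v /= h1 h2; lia.
by have /allP/(_ _ xs) := order_path_min tr Hs.
Qed.

(** Both sides say that cell [(i, j)] lies in the diagram: the entries exceeding [j] form an initial
    segment of a nonincreasing list. The facts below about conjugation rest on this exchange of [i]
    and [j]. *)
Lemma ltn_count s i j : sorted geq s -> (i < count (ltn j) s) = (j < nth 0 s i).
Proof.
elim: s i => [|a s IH] i Hs /=; first by rewrite nth_nil.
have IHs := IH _ (path_sorted Hs).
have [ja|aj] := ltnP j a.
  case: i => [|i] /=; first by rewrite ja.
  by rewrite add1n ltnS IHs.
have le_j x : x \in a :: s -> x <= j.
  by rewrite inE => /predU1P[->//|/(sorted_geq_le_head Hs) xa]; exact: leq_trans aj.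
have -> : count (ltn j) s = 0.
  apply/eqP; rewrite eqn0Ngt -has_count; apply/hasPn => x xs.
  by rewrite /= -leqNgt le_j // inE xs orbT.
have [ilt|ige] := ltnP i (size (a :: s)); last by rewrite nth_default.
by have := le_j _ (mem_nth 0 ilt); rewrite leqNgt => /negbTE ->.
Qed.

Lemma nth_conj_part s j : sorted geq s -> nth 0 (conj_part s) j = count (ltn j) s.
Proof.
move=> Hs; case: (ltnP j (head 0 s)) => jh; first by rewrite nth_mkseq.
(* Past the last column the default [0] agrees with the count, as no entry exceeds the head. *)
rewrite nth_default ?size_mkseq //; apply/esym/eqP.
by rewrite eqn0Ngt ltn_count // nth0 -leqNgt.
Qed.

Lemma conj_part_parts s : sorted geq s -> parts (conj_part s).
Proof.
move=> Hs; apply/andP; split.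
  apply/(sortedP 0) => i; rewrite size_mkseq => ih.
  rewrite !nth_mkseq ?(ltnW ih) //=; apply: sub_count => x /=; lia.
apply/allP => x /mapP[j]; rewrite mem_iota => jh ->.
by rewrite inE ltn_count // nth0.
Qed.

(** Positive parts make the size visible as the number of nonzero entries, so padding by the default
    [0] loses nothing. *)
Lemma eq_parts s t : parts s -> parts t ->
  (forall i, nth 0 s i = nth 0 t i) -> s = t.
Proof.
move=> /andP[_ ps] /andP[_ pt] e.
have ltn_size u i : all (ltn 0) u -> (i < size u) = (0 < nth 0 u i).
  move=> pu; case: ltnP => iu; last by rewrite nth_default.
  by have /= -> := allP pu _ (mem_nth 0 iu).
apply: (@eq_from_nth _ 0) => [|i _]; last exact: e.
by apply: eq_ltn => i; rewrite !ltn_size // e.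
Qed.

Lemma conj_partK s : parts s -> conj_part (conj_part s) = s.
Proof.
move=> ps; have /andP[Hs _] := ps.
have /andP[Hc _] := conj_part_parts Hs.
apply: eq_parts => [|//|i]; first exact: conj_part_parts.
apply: eq_ltn => j.
by rewrite nth_conj_part // ltn_count // nth_conj_part // ltn_count.
Qed.

Definition tri (k : nat) : nat := (k * (k + 1)) %/ 2.

Lemma tri_sum k : tri k = \sum_(i < k) i.+1.
Proof.
elim: k => [|k IH]; first by rewrite big_ord0.
rewrite big_ord_recr /= -IH /tri.
by rewrite (_ : k.+1 * (k.+1 + 1) = k * (k + 1) + k.+1 * 2) ?divnMDl 1?addnC //; [lia | nia].
Qed.

Lemma triS k : tri k.+1 = tri k + k.+1.
Proof. by rewrite !tri_sum big_ord_recr. Qed.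

Lemma leq_tri k : k <= tri k.
Proof. by case: k => // k; rewrite triS leq_addl. Qed.

Lemma tri_mono : {mono tri : i j / i <= j}.
Proof. by apply: leq_mono; apply: homo_ltn ltn_trans _ => k; rewrite triS; lia. Qed.

(** Searching [tri 0], ..., [tri t] suffices because [k <= tri k]; the value is meaningful only for
    triangular [t]. *)
Definition tri_inv (t : nat) : nat := index t (mkseq tri t.+1).

Lemma tri_inv_tri k : tri_inv (tri k) = k.
Proof.
have Hk : tri k \in mkseq tri (tri k).+1.
  by apply/mapP; exists k; rewrite // mem_iota /= add0n ltnS leq_tri.
have := nth_index 0 Hk; rewrite nth_mkseq; last by rewrite -[X in _ < X](size_mkseq tri) index_mem.
exact: incn_inj tri_mono _ _.
Qed.

Lemma triangular_tri t : triangular t -> 0 < tri_inv t /\ tri (tri_inv t) = t.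
Proof. by case/triangularP => k k0 ->; rewrite -/(tri k) tri_inv_tri. Qed.

Definition weight (s : seq nat) : nat := \sum_(i < size s) i.+1 * nth 0 s i.

(* Both sides count the cells of the Young diagram of [s], a cell of row [i]
   being counted with multiplicity [i.+1]. *)
Lemma sumn_tri_conj s : sorted geq s -> sumn (map tri (conj_part s)) = weight s.
Proof.
move=> Hs; rewrite sumnE !big_map -[head 0 s]subn0 -/(index_iota _ _) big_mkord /weight.
have cell n a (F : nat -> nat) : a <= n -> \sum_(i < a) F i = \sum_(i < n | i < a) F i.
  by move=> an; rewrite (big_ord_widen n F).
transitivity (\sum_(j < head 0 s) \sum_(i < size s | j < nth 0 s i) i.+1).
  apply: eq_bigr => j _; rewrite tri_sum (cell (size s)) ?count_size //.
  by apply: eq_bigl => i; rewrite ltn_count.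
rewrite (exchange_big_dep xpredT) //=; apply: eq_bigr => i _.
rewrite -(cell _ _ (fun=> i.+1)) ?sum_nat_const ?card_ord 1?mulnC //.
case: s Hs i => [|a s] Hs [[|i] //= Hi]; exact: sorted_geq_le_head Hs _ (mem_nth 0 Hi).
Qed.

(** The only value which, put in front of [s], gives cyclicity index zero. *)
Definition first_part (s : seq nat) : nat := \sum_(i < size s) (2 * i + 1) * nth 0 s i.

Lemma cyclicity_index_cons a s :
  cyclicity_index (a :: s) = (a%:Z - (first_part s)%:Z)%R.
Proof.
rewrite /cyclicity_index /= big_add1 /= big_mkord big_ord_recl /=; congr (_ + _)%R.
  by rewrite GRing.mul1r.
rewrite /first_part (big_morph Posz PoszD (erefl _)) -GRing.sumrN.
(* Entry [i] of the tail is part number [i + 2], with coefficient [3 - 2 (i + 2) = - (2 i + 1)]. *)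
by apply: eq_bigr => i _; rewrite /bump /=; move: (nth 0 s i) => x; nia.
Qed.

(** Coefficientwise, [(2 i + 1) + 1 = 2 (i + 1)]. The left side is the total of
    [first_part s :: s]. *)
Lemma sumn_first_part s : first_part s + sumn s = 2 * weight s.
Proof.
rewrite sumnE (big_nth 0) big_mkord /first_part /weight big_distrr -big_split /=.
by apply: eq_bigr => i _; nia.
Qed.

Lemma head_le_first_part s : head 0 s <= first_part s.
Proof.
by case: s => [|a s]; rewrite /first_part ?big_ord0 // big_ord_recl /= mul1n leq_addr.
Qed.

Lemma cyclicity_zeroP m s : 0 < m ->
  reflect (exists2 t, s = first_part t :: t & parts t /\ weight t = m)
          (is_partition (2 * m) s && (cyclicity_index s == 0%R)).
Proof.
move=> m0; apply: (iffP idP) => [|[t -> [pt wt]]].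
  case: s => [|a s] /andP[/and3P[Hs ps /eqP /= Hm]]; first by lia.
  rewrite cyclicity_index_cons GRing.subr_eq0 => /eqP[ea].
  exists s; first by rewrite -ea.
  split; first by apply: (@parts_behead a); rewrite /parts Hs.
  by have := sumn_first_part s; lia.
rewrite cyclicity_index_cons GRing.subrr eqxx andbT /is_partition /=.
rewrite sumn_first_part wt eqxx andbT.
have /andP[Ht pos] := pt; have hd := head_le_first_part t.
apply/and3P; split=> //.
  by case: t hd Ht {pos pt wt} => //= b t -> ->.
(* The new first part is positive: [m > 0] forces [t] to be nonempty, and its head is positive. *)
apply: leq_trans hd; case: t wt pos {Ht pt} => [|b t] /=; last by move=> _ /andP[].
by rewrite /weight big_ord0; lia.
Qed.

Lemma map_tri_invK s : map tri_inv (map tri s) = s.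
Proof. by rewrite mapK //; exact: tri_inv_tri. Qed.

Lemma map_triK s : all triangular s -> map tri (map tri_inv s) = s.
Proof.
move=> /allP Hs; rewrite -map_comp map_id_in // => t /Hs /triangular_tri[_]; exact.
Qed.

(** [tri] preserves and reflects the order, and [k <= tri k] keeps parts positive, so [s] amounts to
    its list of triangular indices. *)
Lemma triangular_partitionP m s :
  reflect (exists2 t, s = map tri t & parts t /\ sumn (map tri t) = m)
          (is_partition m s && all triangular s).
Proof.
apply: (iffP idP) => [/andP[/and3P[Hs ps /eqP Hm] ts]|[t -> [/andP[Ht pt] Hm]]].
  exists (map tri_inv s); rewrite map_triK //; split=> //.
  apply/andP; split.
    rewrite -(map_triK ts) sorted_map in Hs.
    by apply: sub_sorted Hs => i j /=; rewrite tri_mono.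
  by apply/allP => _ /mapP[x /(allP ts)/triangular_tri[x0 _] ->].
rewrite /is_partition Hm eqxx andbT sorted_map -andbA; apply/and3P; split.
- by apply: sub_sorted Ht => i j /=; rewrite tri_mono.
- apply/allP => _ /mapP[x /(allP pt) /= x0 ->]; exact: leq_trans x0 (leq_tri x).
- by apply/allP => _ /mapP[x /(allP pt) /= x0 ->]; apply/triangularP; exists x.
Qed.

(** Membership proofs for boolean predicates are unique, so inverse laws on the underlying values
    suffice. *)
Lemma bijective_sig (S T : Type) (P : pred S) (Q : pred T) (f : S -> T) (g : T -> S) :
    (forall x, P x -> Q (f x)) -> (forall y, Q y -> P (g y)) ->
    {in P, cancel f g} -> {in Q, cancel g f} ->
  exists h : {x | P x} -> {y | Q y}, bijective h.
Proof.
move=> PQ QP fK gK.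
exists (fun x => exist _ (f (val x)) (PQ _ (valP x))).
exists (fun y => exist _ (g (val y)) (QP _ (valP y))) => [[x Px]|[y Qy]]; apply: val_inj.
- exact: fK.
- exact: gK.
Qed.

Theorem theorem1p2 (m : nat) (hm : 1 <= m) :
  exists f : cyclicity_zero_partition (2 * m) -> triangular_partition m,
    bijective f.
Proof.
apply: (@bijective_sig _ _ _ _
  (fun s => map tri (conj_part (behead s)))
  (fun s => let t := conj_part (map tri_inv s) in first_part t :: t)).
- move=> _ /(cyclicity_zeroP _ hm)[t -> [pt wt]]; have /andP[Ht _] := pt.
  apply/triangular_partitionP; exists (conj_part t) => //.
  by rewrite conj_part_parts // sumn_tri_conj.
- move=> _ /triangular_partitionP[t -> [pt wt]]; have /andP[Ht _] := pt.
  apply/(cyclicity_zeroP _ hm); exists (conj_part t); first by rewrite map_tri_invK.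
  have pc := conj_part_parts Ht; have /andP[Hc _] := pc.
  (* The weight of the conjugate of [t] is the sum of [tri] over its double conjugate, which is
     [t]. *)
  by rewrite -sumn_tri_conj // conj_partK.
- move=> _ /(cyclicity_zeroP _ hm)[t -> [pt _]] /=.
  by rewrite map_tri_invK conj_partK.
- move=> _ /triangular_partitionP[t -> [pt _]] /=.
  by rewrite map_tri_invK conj_partK.
Qed.
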